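(* Let $k$ be a field of characteristic zero and let $\mathfrak{g}$ be the free $4$-step nilpotent Lie algebra over $k$ on $2$ generators $x_1,x_2$ (which is a $2$-step solvable Lie algebra). Explicitly, $\mathfrak{g}$ has basis $(x_1,\ldots,x_8)$ with $$x_3=[x_1,x_2],\quad x_4=[x_1,x_3],\quad x_5=[x_2,x_3],\quad x_6=[x_1,x_4],\quad x_7=[x_2,x_4]=[x_1,x_5],\quad x_8=[x_2,x_5],$$ all other brackets of basis vectors (up to antisymmetry) being zero. Then $\mathfrak{g}$ admits an LR-structure.
   Context: An LR-structure on a Lie algebra $\mathfrak{g}$ over $k$ is a bilinear product $\mathfrak{g}\times\mathfrak{g}\to\mathfrak{g}$, $(x,y)\mapsto x\cdot y$, satisfying for all $x,y,z\in\mathfrak{g}$: $x\cdot(y\cdot z)=y\cdot(x\cdot z)$, $(x\cdot y)\cdot z=(x\cdot z)\cdot y$, and $[x,y]=x\cdot y-y\cdot x$. A Lie algebra $\mathfrak{g}$ is $2$-step solvable if $[[\mathfrak{g},\mathfrak{g}],[\mathfrak{g},\mathfrak{g}]]=0$. *)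

(* Defs.v *)
From HB Require Import structures.
From mathcomp Require Import all_boot all_order all_algebra.

Set Implicit Arguments.
Unset Strict Implicit.
Unset Printing Implicit Defensive.

Import GRing.Theory.
Local Open Scope ring_scope.

Notation bilinear_op m := (bilinear_for *:%R *:%R m).

HB.mixin Record Lmodule_isLieAlgebra (k : fieldType) (g : Type)
    & GRing.Lmodule k g := {
  lie : g -> g -> g;
  lie_bilinear : bilinear_op lie;
  liexx : forall x, lie x x = 0;
  lie_jacobi : forall x y z,
    lie x (lie y z) + lie y (lie z x) + lie z (lie x y) = 0
}.

(* The dimension is not assumed to be finite. *)
#[short(type="lieAlgType")]
HB.structure Definition LieAlgebra (k : fieldType) :=
  { g of GRing.Lmodule k g & Lmodule_isLieAlgebra k g }.

Notation "[lie x , y ]" := (lie x y)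
  (at level 0, x, y at level 99, format "[lie  x ,  y ]") : ring_scope.

(* The subspace [A, B], i.e. the linear span of the brackets [a, b] with
   a in A and b in B; subspaces are given by their membership predicates. *)
Inductive lie_commutator (k : fieldType) (g : lieAlgType k)
    (A B : g -> Prop) : g -> Prop :=
| Lie_commutator_bracket x y : A x -> B y -> lie_commutator A B [lie x, y]
| Lie_commutator0 : lie_commutator A B 0
| Lie_commutatorP (a : k) x y :
    lie_commutator A B x -> lie_commutator A B y ->
    lie_commutator A B (a *: x + y).

(* Indexed from 0: lie_lower_central g 0 = g and
   lie_lower_central g 1 = [g, g]. *)
Fixpoint lie_lower_central (k : fieldType) (g : lieAlgType k) (n : nat) :
    g -> Prop :=
  if n is n'.+1 then lie_commutator (fun _ => True) (@lie_lower_central k g n')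
  else fun _ => True.

Fixpoint lie_derived_series (k : fieldType) (g : lieAlgType k) (n : nat) :
    g -> Prop :=
  if n is n'.+1 then
    lie_commutator (@lie_derived_series k g n') (@lie_derived_series k g n')
  else fun _ => True.

(* Nilpotent of class at most c. *)
Definition step_nilpotent (c : nat) (k : fieldType) (g : lieAlgType k) : Prop :=
  forall x : g, lie_lower_central c x -> x = 0.

(* Solvable of derived length at most d; for d = 2 this is
   [[g, g], [g, g]] = 0. *)
Definition step_solvable (d : nat) (k : fieldType) (g : lieAlgType k) : Prop :=
  forall x : g, lie_derived_series d x -> x = 0.

Definition lie_morphism (k : fieldType) (g h : lieAlgType k) (f : g -> h) :
    Prop :=
  linear f /\ {morph f : x y / [lie x, y]}.

(* g is the free c-step nilpotent Lie algebra on the generators e_0, ...,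
   e_(n-1), in terms of the universal property. *)
Definition free_nilpotent (c : nat) (k : fieldType) (g : lieAlgType k)
    (n : nat) (e : 'I_n -> g) : Prop :=
  step_nilpotent c g /\
  forall (h : lieAlgType k) (a : 'I_n -> h), step_nilpotent c h ->
    exists f : g -> h,
      [/\ lie_morphism f,
          forall i, f (e i) = a i
        & forall f' : g -> h, lie_morphism f' ->
            (forall i, f' (e i) = a i) -> f' =1 f].

Definition is_basis (k : fieldType) (V : lmodType k) (n : nat) (b : 'I_n -> V) :
    Prop :=
  forall v : V, exists! c : 'rV[k]_n, v = \sum_i c 0 i *: b i.

(* The basis vectors are x 1, ..., x 8; the other values of x are irrelevant. *)
Definition free4_basis (k : fieldType) (g : lieAlgType k) (x : nat -> g) :
    Prop :=
  [/\ is_basis (fun i : 'I_8 => x i.+1),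
      [/\ x 3%N = [lie x 1%N, x 2%N], x 4%N = [lie x 1%N, x 3%N]
        & x 5%N = [lie x 2%N, x 3%N]],
      [/\ x 6%N = [lie x 1%N, x 4%N], x 7%N = [lie x 2%N, x 4%N],
          x 7%N = [lie x 1%N, x 5%N]
        & x 8%N = [lie x 2%N, x 5%N]]
    & forall i j : nat, (1 <= i < j)%N -> (j <= 8)%N ->
        (i, j) \notin [:: (1, 2); (1, 3); (2, 3); (1, 4); (2, 4);
                          (1, 5); (2, 5)]%N ->
        [lie x i, x j] = 0].

Record LR_structure (k : fieldType) (g : lieAlgType k) (m : g -> g -> g) :
    Prop := {
  LR_bilinear : bilinear_op m;
  LR_left : forall x y z, m x (m y z) = m y (m x z);
  LR_right : forall x y z, m (m x y) z = m (m x z) y;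
  LR_lie : forall x y, [lie x, y] = m x y - m y x
}.

(* Main.v *)
Require Import Defs.
From HB Require Import structures.
From mathcomp Require Import all_boot all_order all_algebra.
From mathcomp Require Import ring zify.

Set Implicit Arguments.
Unset Strict Implicit.
Unset Printing Implicit Defensive.

Import GRing.Theory.
Local Open Scope ring_scope.

(** The free metabelian Lie algebra on two generators has a concrete model.
    Let A be the polynomial ring k[s,t], on which ad x_1 and ad x_2 are to act
    as multiplication by s and t, and let h = k^2 + A, where 1 in A stands for
    [x_1, x_2].  For u = (a, b, p) put alpha(u) = a - t p and
    beta(u) = b + s p, both in A.  Then u . v = (0, 0, alpha(u) beta(v)) is an
    LR-product:
      x . (y . z) = s alpha(x) alpha(y) beta(z)  is symmetric in x and y,
      (x . y) . z = - t alpha(x) beta(y) beta(z)  is symmetric in y and z,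
    because A is commutative.  Its commutator sends (a, b, p), (a', b', p') to
    (a b' - a' b) + (a s + b t) p' - (a' s + b' t) p, which is the metabelian
    bracket wanted.  Truncating A to degree at most 2 gives an 8-dimensional
    algebra of class 4, with basis
      x_1, x_2, x_3 = 1, x_4 = s, x_5 = t, x_6 = s^2, x_7 = s t, x_8 = t^2;
    this is [free4], with product [free4_mul].

    It remains to identify an arbitrary free 4-step nilpotent g with free4.
    Freeness gives a morphism f from g to free4 that respects the generators.
    Conversely, the eight bracket words in the generators of any 4-step
    nilpotent algebra multiply like the basis of free4: brackets of words of
    total degree at least 5 vanish by nilpotency, and [x_2, x_4] = [x_1, x_5]
    is the Jacobi identity.  Sending basis vectors to words is therefore a
    morphism from free4 to g ([free4_comb_morphism]).  The two maps are inverse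
    to each other, as all morphisms involved are determined by the generators.
    So the words are a basis of g and the product of free4 can be transported
    to g.  Finally g is 2-step solvable because every Lie algebra with an
    LR-structure is ([LR_step_solvable2]). *)

(** * Brackets and the lower central series *)

(** Gives access to the generic lemmas on bilinear maps. *)
HB.instance Definition _ (k : fieldType) (g : lieAlgType k) :=
  bilinear_isBilinear.Build k g g g *:%R *:%R (@lie k g) (@lie_bilinear k g).

Section LieTheory.
Variables (k : fieldType) (g : lieAlgType k).
Implicit Types x y z : g.

Lemma lieC x y : [lie x, y] = - [lie y, x].
Proof.
apply/eqP; rewrite -addr_eq0; apply/eqP.
have := liexx (x + y).
by rewrite linearDl !linearDr /= !liexx add0r addr0.
Qed.

Lemma lie_leibniz x y z :
  [lie x, [lie y, z]] = [lie [lie x, y], z] + [lie y, [lie x, z]].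
Proof.
apply/eqP; rewrite -subr_eq0; apply/eqP; rewrite -(lie_jacobi x y z).
rewrite (lieC [lie x, y] z) (lieC x z) linearNr /=.
by rewrite opprD !opprK addrA addrAC.
Qed.

Lemma lieZZ a b x y : [lie a *: x, b *: y] = a *: (b *: [lie x, y]).
Proof. by rewrite linearZl_LR linearZr_LR. Qed.

Lemma lie_lower_centralP n (a : k) x y :
  lie_lower_central n x -> lie_lower_central n y ->
  lie_lower_central n (a *: x + y).
Proof. by case: n => [|n] //; apply: Lie_commutatorP. Qed.

Lemma lie_lower_central0 n : lie_lower_central n (0 : g).
Proof. by case: n => [|n] //; apply: Lie_commutator0. Qed.

Lemma lie_lower_centralS n x :
  lie_lower_central n.+1 x -> lie_lower_central n x.
Proof.
elim: n x => [|n IHn] x //; elim=> {x} [x y _ /IHn||a x y _ ? _ ?].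
- exact: Lie_commutator_bracket.
- exact: lie_lower_central0.
- exact: lie_lower_centralP.
Qed.

Lemma lie_lower_central_le m n x :
  (m <= n)%N -> lie_lower_central n x -> lie_lower_central m x.
Proof. by move/subnK <-; elim: (n - m)%N => //= d IHd /lie_lower_centralS. Qed.

(** With the m-th term placed in degree m + 1, brackets add degrees.  By the
    Jacobi identity, bracketing with [x, z] reduces to bracketing with z, which
    lies one term higher up. *)
Lemma lie_lower_central_lie m n x y :
  lie_lower_central m x -> lie_lower_central n y ->
  lie_lower_central (m + n).+1 [lie x, y].
Proof.
elim: m n x y => [|m IHm] n x y.
  by move=> _; apply: Lie_commutator_bracket.
move=> x_m y_n; elim: x_m => {x} [x z _ z_m||a x z _ IHx _ IHz].
- have -> : [lie [lie x, z], y] =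
            - 1 *: [lie z, [lie x, y]] + [lie x, [lie z, y]].
    by rewrite (lie_leibniz x) scaleN1r addrC addrK.
  apply: lie_lower_centralP.
    by rewrite addSnnS; apply: IHm => //; apply: Lie_commutator_bracket.
  by rewrite addSn; apply: Lie_commutator_bracket => //; apply: IHm.
- by rewrite linear0l; apply: lie_lower_central0.
- by rewrite linearPl; apply: lie_lower_centralP.
Qed.

End LieTheory.

Lemma lie_morphism_comp (k : fieldType) (g h l : lieAlgType k)
    (f : h -> l) (f' : g -> h) :
  lie_morphism f -> lie_morphism f' -> lie_morphism (f \o f').
Proof.
move=> [lin_f lie_f] [lin_f' lie_f']; split=> [a x y|x y] /=.
  by rewrite lin_f' lin_f.
by rewrite lie_f' lie_f.
Qed.

(** * Products with commuting left and commuting right multiplications *)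

Section LRTheory.
Variables (k : fieldType) (V : lmodType k) (m : V -> V -> V).
Hypothesis m_bil : bilinear_op m.
Hypothesis mCA : forall x y z, m x (m y z) = m y (m x z).
Hypothesis mAC : forall x y z, m (m x y) z = m (m x z) y.

HB.instance Definition _ :=
  bilinear_isBilinear.Build k V V V *:%R *:%R m m_bil.

Lemma LR_swap13 x y z t : m (m x y) (m z t) = m (m z y) (m x t).
Proof. by rewrite mAC mCA mAC. Qed.

Lemma LR_swap24 x y z t : m (m x y) (m z t) = m (m x t) (m z y).
Proof. by rewrite mCA mAC mCA. Qed.

Let c x y := m x y - m y x.

(** Applying both swaps shows that any two products commute under m, hence so
    do any two commutators. *)
Lemma LR_commutator_abelian x y z t : c (c x y) (c z t) = 0.
Proof.
suff mC a b a' b' : m (c a b) (c a' b') = m (c a' b') (c a b).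
  by rewrite {1}/c mC subrr.
rewrite /c !linearBl !linearBr /=.
have E p q p' q' : m (m p q) (m p' q') = m (m p' q') (m p q).
  by rewrite LR_swap13 LR_swap24.
rewrite (E a b a' b') (E a b b' a') (E b a a' b') (E b a b' a').
by rewrite !opprB addrACA [RHS]addrACA; congr (_ + _); apply: addrC.
Qed.

Lemma LR_commutator_bilinear : bilinear_op c.
Proof.
by split=> u a x y; rewrite /c linearPl linearPr /= opprD scalerBr addrACA.
Qed.

(** Each double commutator is a difference of two values of an expression p
    that is symmetric in its first two arguments; the cyclic sum telescopes. *)
Lemma LR_commutator_jacobi x y z :
  c x (c y z) + c y (c z x) + c z (c x y) = 0.
Proof.
have E u v w : c u (c v w) =
    (m u (m v w) + m (m w v) u) - (m u (m w v) + m (m v w) u).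
  by rewrite /c linearBl linearBr /= opprB addrACA opprD.
pose p u v w := m u (m v w) + m (m w v) u.
have pC u v w : p u v w = p v u w by rewrite /p mCA mAC.
rewrite !E -!/(p _ _ _) (pC y x z) (pC z x y) (pC z y x).
by rewrite addrAC !subrKA subrr.
Qed.
End LRTheory.

Lemma LR_step_solvable2 (k : fieldType) (g : lieAlgType k) (m : g -> g -> g) :
  LR_structure m -> step_solvable 2 g.
Proof.
case=> m_bil mCA mAC lieE.
have lie0 (u v : g) : lie_derived_series 1 u -> lie_derived_series 1 v ->
    [lie u, v] = 0.
  elim=> {u} [x y _ _||a u u' _ IHu _ IHu'].
  - elim=> {v} [z t _ _||a v v' _ IHv _ IHv'].
    + by rewrite !lieE (LR_commutator_abelian m_bil).
    + exact: linear0r.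
    + by rewrite linearPr /= IHv IHv' scaler0 addr0.
  - by move=> _; apply: linear0l.
  - by move=> v1; rewrite linearPl /= IHu // IHu' // scaler0 addr0.
move=> x; elim=> {x} [u v u1 v1||a u v _ -> _ ->] //; first exact: lie0.
by rewrite scaler0 addr0.
Qed.

Lemma LR_structure_transport (k : fieldType) (g h : lieAlgType k)
    (f : g -> h) (f' : h -> g) (m : h -> h -> h) :
  lie_morphism f -> linear f' -> cancel f f' -> cancel f' f ->
  LR_structure m -> LR_structure (fun x y => f' (m (f x) (f y))).
Proof.
move=> [lin_f lie_f] lin_f' fK f'K [m_bil mCA mAC lieE].
split=> [|x y z|x y z|x y]; rewrite ?f'K.
- by split=> u a x y /=; rewrite lin_f m_bil lin_f'.
- by rewrite mCA.
- by rewrite mAC.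
- by rewrite -[LHS]fK lie_f lieE addrC -scaleN1r lin_f' scaleN1r addrC.
Qed.

(** * The eight-dimensional model *)

(** A copy of the row space, so that the Lie bracket below is attached to this
    type only. *)
Definition free4 (k : fieldType) : Type := 'rV[k]_8.
HB.instance Definition _ (k : fieldType) := GRing.Lmodule.on (free4 k).

Section Model.
Variable k : fieldType.
Local Notation h := (free4 k).
(* Coordinates are numbered from 1, like the basis vectors x_1, ..., x_8. *)
Local Notation "u #_ i" := ((u : 'rV[k]_8) 0 (@Ordinal 8 i.-1 isT))
  (at level 2, i at level 0, format "u #_ i").

(** The expansion of (a - t p) (b' + s p') modulo polynomials of degree 3, in
    the monomials 1, s, t, s^2, s t, t^2. *)
Definition free4_mul (u v : h) : h := \row_(i < 8)
  [:: 0; 0;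
      u#_1 * v#_2;
      u#_1 * v#_3; - u#_3 * v#_2;
      u#_1 * v#_4; u#_1 * v#_5 - u#_4 * v#_2 - u#_3 * v#_3; - u#_5 * v#_2]`_i.

Lemma rowP8 (u v : h) :
  [/\ u#_1 = v#_1, u#_2 = v#_2, u#_3 = v#_3 & u#_4 = v#_4] ->
  [/\ u#_5 = v#_5, u#_6 = v#_6, u#_7 = v#_7 & u#_8 = v#_8] -> u = v.
Proof.
move=> [u1 u2 u3 u4] [u5 u6 u7 u8]; apply/rowP=> -[i lt_i8].
case: i lt_i8 => [|[|[|[|[|[|[|[|//]]]]]]]] lt_i8.
all: by rewrite (bool_irrelevance lt_i8 isT).
Qed.

Lemma free4_mul_bilinear : bilinear_op free4_mul.
Proof.
by split=> u a x y; apply: rowP8; split; rewrite !mxE /= ?mxE /=; ring.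
Qed.

Lemma free4_mulCA x y z :
  free4_mul x (free4_mul y z) = free4_mul y (free4_mul x z).
Proof. by apply: rowP8; split; rewrite !mxE /= ?mxE /=; ring. Qed.

Lemma free4_mulAC x y z :
  free4_mul (free4_mul x y) z = free4_mul (free4_mul x z) y.
Proof. by apply: rowP8; split; rewrite !mxE /= ?mxE /=; ring. Qed.

Definition free4_lie (u v : h) : h := free4_mul u v - free4_mul v u.

Lemma free4_liexx u : free4_lie u u = 0.
Proof. exact: subrr. Qed.

HB.instance Definition _ := Lmodule_isLieAlgebra.Build k h
  (LR_commutator_bilinear free4_mul_bilinear) free4_liexx
  (LR_commutator_jacobi free4_mul_bilinear free4_mulCA free4_mulAC).

Lemma free4_mul_LR : LR_structure (free4_mul : h -> h -> h).
Proof.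
split=> //; first exact: free4_mul_bilinear.
- exact: free4_mulCA.
- exact: free4_mulAC.
Qed.

(** The degree of x_{i+1} as a bracket word in x_1 and x_2. *)
Definition free4_degree (i : nat) : nat := nth 0 [:: 1; 1; 2; 3; 3; 4; 4; 4] i.

(** The bracket is graded: a coordinate of [u, v] involves only coordinates of
    v of smaller degree. *)
Lemma free4_lower_central n (u : h) (i : 'I_8) :
  lie_lower_central n u -> (free4_degree i <= n)%N -> (u : 'rV_8) 0 i = 0.
Proof.
elim: n u i => [|n IHn] u i; first by case: i => [] [|[|[|[|[|[|[|[|//]]]]]]]].
elim=> {u} [u v _ /IHn v0||a u v _ IHu _ IHv] deg_i; last 2 first.
- by rewrite mxE.
- by rewrite !mxE IHu // IHv // mulr0 addr0.
rewrite /lie /= !mxE.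
case: i deg_i => [] [|[|[|[|[|[|[|[|//]]]]]]]] lt_i8 deg_i /=.
all: rewrite ?v0 ?mulr0 ?mul0r; try by rewrite -ltnS; apply: leq_trans deg_i.
all: ring.
Qed.

Lemma free4_step_nilpotent : step_nilpotent 4 h.
Proof.
move=> u u4; apply/rowP=> i; rewrite mxE; apply: free4_lower_central u4 _.
by case: i => [] [|[|[|[|[|[|[|[|//]]]]]]]].
Qed.
End Model.

(** * Bracket words in two elements *)

Section Words.
Variable k : fieldType.

(** The entry of index 0 is a dummy, so that the words are numbered from 1. *)
Definition free4_words (g : lieAlgType k) (x1 x2 : g) : nat -> g :=
  let x3 := [lie x1, x2] in
  let x4 := [lie x1, x3] in
  let x5 := [lie x2, x3] in
  nth 0 [:: 0; x1; x2; x3; x4; x5; [lie x1, x4]; [lie x1, x5]; [lie x2, x5]].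

Definition free4_comb (g : lieAlgType k) (x1 x2 : g) (c : free4 k) : g :=
  \sum_i (c : 'rV_8) 0 i *: free4_words x1 x2 i.+1.

Lemma free4_comb_morph (g h : lieAlgType k) (f : g -> h) x1 x2 c :
  lie_morphism f -> f (free4_comb x1 x2 c) = free4_comb (f x1) (f x2) c.
Proof.
move=> [lin_f lie_f].
pose fL : {linear g -> h} := HB.pack f (GRing.isLinear.Build k g h *:%R f lin_f).
rewrite /free4_comb -[f]/(fL : _ -> _) linear_sum; apply: eq_bigr => i _.
rewrite linearZ /=; congr (_ *: _).
by case: i => [] [|[|[|[|[|[|[|[|//]]]]]]]] lt_i8 //=; rewrite !lie_f.
Qed.

Lemma free4_comb_linear (g : lieAlgType k) (x1 x2 : g) :
  linear (free4_comb x1 x2).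
Proof.
move=> a c d; rewrite /free4_comb scaler_sumr -big_split.
by apply: eq_bigr => i _ /=; rewrite !mxE scalerDl scalerA.
Qed.

Lemma free4_comb_delta (g : lieAlgType k) (x1 x2 : g) i :
  free4_comb x1 x2 (delta_mx 0 i : 'rV_8) = free4_words x1 x2 i.+1.
Proof.
rewrite /free4_comb (bigD1 i) //= !mxE !eqxx scale1r big1 ?addr0 // => j neq_ji.
by rewrite mxE (negPf neq_ji) andbF scale0r.
Qed.

Section Nilpotent.
Variables (g : lieAlgType k) (x1 x2 : g).
Hypothesis nil_g : step_nilpotent 4 g.
Local Notation x := (free4_words x1 x2).

Lemma free4_words_lower_central (i : 'I_8) :
  lie_lower_central (free4_degree i).-1 (x i.+1).
Proof.
case: i => [] [|[|[|[|[|[|[|[|//]]]]]]]] lt_i8 //=.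
all: by do ?apply: Lie_commutator_bracket.
Qed.

Lemma free4_words_lie0 (i j : 'I_8) :
  (4 < free4_degree i + free4_degree j)%N -> [lie x i.+1, x j.+1] = 0.
Proof.
move=> deg_ij; apply: nil_g.
apply: lie_lower_central_le (lie_lower_central_lie
  (free4_words_lower_central i) (free4_words_lower_central j)).
have deg_gt0 (l : 'I_8) : (0 < free4_degree l)%N.
  by case: l => [] [|[|[|[|[|[|[|[|//]]]]]]]].
by have := deg_gt0 i; have := deg_gt0 j; lia.
Qed.

(** The only coincidence among the words of degree 4: the Jacobi identity for
    x_1, x_2 and x_3, since [x_3, x_3] = 0. *)
Lemma free4_words_lie24 : [lie x 2, x 4] = x 7.
Proof. by rewrite /= lie_leibniz (lieC x2 x1) linearNl /= liexx oppr0 add0r. Qed.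

Lemma free4_words_lie_notin (i j : nat) : (1 <= i < j)%N -> (j <= 8)%N ->
  (i, j) \notin [:: (1, 2); (1, 3); (2, 3); (1, 4); (2, 4);
                    (1, 5); (2, 5)]%N ->
  [lie x i, x j] = 0.
Proof.
case: i => // i; case: j => // j lt_ij lt_j8 notin_ij.
have lt_i8 : (i < 8)%N by apply: ltn_trans lt_j8.
apply: (free4_words_lie0 (i := Ordinal lt_i8) (j := Ordinal lt_j8)) => /=.
case: i lt_ij lt_i8 notin_ij => [|[|[|[|[|[|[|[|//]]]]]]]] lt_ij _.
all: by case: j lt_ij lt_j8 => [|[|[|[|[|[|[|[|//]]]]]]]].
Qed.

(** The multiplication table of the model is that of the words, entry by
    entry. *)
Lemma free4_comb_lie_delta (i j : 'I_8) : (i < j)%N ->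
  free4_comb x1 x2 [lie (delta_mx 0 i : 'rV_8) : free4 k,
                        (delta_mx 0 j : 'rV_8) : free4 k]
  = [lie x i.+1, x j.+1].
Proof.
move=> lt_ij; have lie0 := free4_words_lie0 (i := i) (j := j).
rewrite /free4_comb !big_ord_recl big_ord0 {1}/lie /= !mxE /=.
case: i lt_ij lie0 => [] [|[|[|[|[|[|[|[|//]]]]]]]] lt_i8;
  case: j => [] [|[|[|[|[|[|[|[|//]]]]]]]] lt_j8 // _ lie0.
all: rewrite ?(mul0r, mulr0, mulr1, subr0, sub0r).
all: rewrite ?(oppr0, opprK, subr0, scale0r, scale1r, add0r, addr0).
all: by [|rewrite lie0|rewrite free4_words_lie24].
Qed.

Lemma free4_comb_morphism : lie_morphism (free4_comb x1 x2).
Proof.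
split=> [|u v]; first exact: free4_comb_linear.
pose psi : {linear free4 k -> g} := HB.pack (free4_comb x1 x2)
  (GRing.isLinear.Build k (free4 k) g *:%R _ (free4_comb_linear x1 x2)).
pose d (i : 'I_8) : free4 k := (delta_mx 0 i : 'rV_8).
have lie_d i j : psi [lie d i, d j] = [lie psi (d i), psi (d j)].
  have lt_lie (i' j' : 'I_8) : (i' < j')%N ->
      psi [lie d i', d j'] = [lie psi (d i'), psi (d j')].
    move=> lt_ij; rewrite /psi /= !free4_comb_delta.
    exact: free4_comb_lie_delta.
  case: (ltngtP i j) => [/lt_lie //|/lt_lie E|/val_inj ->].
    by rewrite lieC linearN E /= -lieC.
  by rewrite !liexx linear0.
have dE w : w = \sum_i (w : 'rV_8) 0 i *: d i := row_sum_delta w.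
rewrite -![free4_comb x1 x2 _]/(psi _) (dE u) (dE v).
rewrite linear_sumlz !linear_sum linear_sumlz; apply: eq_bigr => i _.
rewrite linear_sumr linear_sum linear_sumr; apply: eq_bigr => j _.
rewrite -[LHS]/(psi [lie u 0 i *: d i, v 0 j *: d j]).
rewrite -[RHS]/([lie psi (u 0 i *: d i), psi (v 0 j *: d j)]).
by rewrite !(linearZ_LR psi) !lieZZ !(linearZ_LR psi) lie_d.
Qed.
End Nilpotent.

Definition free4_gen (i : 'I_2) : free4 k :=
  (delta_mx 0 (widen_ord (isT : (2 <= 8)%N) i) : 'rV_8).

(** In the model itself, the words in the generators are the standard basis. *)
Lemma free4_comb_gen c : free4_comb (free4_gen ord0) (free4_gen ord_max) c = c.
Proof.
rewrite /free4_comb [RHS](row_sum_delta (c : 'rV_8)).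
apply: eq_bigr => i _; congr (_ *: _).
pose d i lt_i8 : free4 k := (delta_mx 0 (@Ordinal 8 i lt_i8) : 'rV_8).
have d1 : free4_gen ord0 = d 0 isT by congr (delta_mx _ _); apply: val_inj.
have d2 : free4_gen ord_max = d 1 isT by congr (delta_mx _ _); apply: val_inj.
have d3 : [lie d 0 isT, d 1 isT] = d 2 isT.
  by apply: rowP8; split; rewrite /lie /= !mxE /=; ring.
have d4 : [lie d 0 isT, d 2 isT] = d 3 isT.
  by apply: rowP8; split; rewrite /lie /= !mxE /=; ring.
have d5 : [lie d 1 isT, d 2 isT] = d 4 isT.
  by apply: rowP8; split; rewrite /lie /= !mxE /=; ring.
have d6 : [lie d 0 isT, d 3 isT] = d 5 isT.
  by apply: rowP8; split; rewrite /lie /= !mxE /=; ring.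
have d7 : [lie d 0 isT, d 4 isT] = d 6 isT.
  by apply: rowP8; split; rewrite /lie /= !mxE /=; ring.
have d8 : [lie d 1 isT, d 4 isT] = d 7 isT.
  by apply: rowP8; split; rewrite /lie /= !mxE /=; ring.
rewrite /free4_words d1 d2 d3 d4 d5 d6 d7 d8.
case: i => [] [|[|[|[|[|[|[|[|//]]]]]]]] lt_i8 /=.
all: by congr (delta_mx _ _); apply: val_inj.
Qed.
End Words.

(** * The free 4-step nilpotent Lie algebra *)

Theorem proposition4p8 (k : fieldType) (g : lieAlgType k) (e : 'I_2 -> g)
    (char_k : [pchar k] =i pred0) (free_g : free_nilpotent 4 e) :
  [/\ step_solvable 2 g,
      exists x : nat -> g,
        [/\ x 1%N = e ord0, x 2%N = e ord_max & free4_basis x]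
    & exists m : g -> g -> g, LR_structure m].
Proof.
have [nil_g univ_g] := free_g.
have [f [morph_f f_e _]] :=
  univ_g (free4 k) (@free4_gen k) (@free4_step_nilpotent k).
pose psi := free4_comb (e ord0) (e ord_max).
have morph_psi : lie_morphism psi by apply: free4_comb_morphism.
have psiK : cancel psi f.
  by move=> c; rewrite free4_comb_morph // !f_e free4_comb_gen.
have psi_gen i : psi (free4_gen k i) = e i.
  rewrite /psi free4_comb_delta.
  by case: i => [] [|[|//]] lt_i2 /=; congr e; apply: val_inj.
have fK : cancel f psi.
  (* The identity and psi \o f are endomorphisms of g fixing the generators. *)
  have [id_g [_ _ id_gP]] := univ_g g e nil_g.
  move=> x; transitivity (id_g x); last by symmetry; apply: (id_gP id).
  apply: (id_gP (psi \o f)) => [|i]; first exact: lie_morphism_comp.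
  by rewrite /= f_e psi_gen.
have LR_m :=
  LR_structure_transport morph_f morph_psi.1 fK psiK (@free4_mul_LR k).
split; first exact: LR_step_solvable2 LR_m.
  exists (free4_words (e ord0) (e ord_max)); split=> //; split=> //.
  - move=> v; exists (f v); split=> [|c ->]; first by rewrite -[LHS]fK.
    exact: psiK.
  - by split=> //; rewrite free4_words_lie24.
  - exact: free4_words_lie_notin.
by exists (fun x y => psi (free4_mul (f x) (f y))).
Qed.
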